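(* For every $0<p<1$, $$\lim_{N\to\infty}\mathbb{E}[Y^2] = -\left(\frac{2}{p^2}-\frac1p-1\right) + 2\sum_{l=1}^{\infty}\frac{a_{2l}+(1-p)a_{l-1}+(1-p)a_l a_{2l}+(1-p)^2a_la_{l-1}}{(1-a_{2l+2})(1-a_{2l})}.$$
   Context: For a real number $0<p<1$ and an integer $N\ge 0$, let $A$ be a random subset of $\{0,\dots,N\}$ in which each integer in $\{0,\dots,N\}$ is included independently with probability $p$, and let $A+A=\{a+b : a,b\in A\}$ ($a=b$ allowed). Let $Y=|\{0\le n\le N : n\notin A+A\}|$. For $k\ge1$, $a_k$ (depending on $p$) is the probability that a random string of zeros and ones of length $k$, with independent entries each equal to $1$ with probability $p$, has no two consecutive entries equal to $1$; and $a_0=1$. *)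

(* Defs.v *)
From HB Require Import structures.
From mathcomp Require Export all_boot all_order all_algebra.
From mathcomp Require Export all_classical all_reals all_analysis.

Set Implicit Arguments.
Unset Strict Implicit.
Unset Printing Implicit Defensive.

Import Order.TTheory GRing.Theory Num.Theory.
Local Open Scope ring_scope.

(* Law of a family (w i)_(i : I) of independent Bernoulli(p) bits: the product
   weight on the finite sample space {ffun I -> bool}. *)
Definition bits_weight (R : realType) (I : finType) (p : R)
    (w : {ffun I -> bool}) : R :=
  \prod_(i : I) (if w i then p else 1 - p).

Definition bits_expect (R : realType) (I : finType) (p : R)
    (X : {ffun I -> bool} -> R) : R :=
  \sum_(w : {ffun I -> bool}) bits_weight p w * X w.

Definition bits_prob (R : realType) (I : finType) (p : R)
    (E : pred {ffun I -> bool}) : R :=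
  \sum_(w : {ffun I -> bool} | E w) bits_weight p w.

Definition random_set (N : nat) (w : {ffun 'I_N.+1 -> bool}) : {set 'I_N.+1} :=
  [set i | w i].

(* Sums are taken in nat, without truncation at N. *)
Definition sumset (N : nat) (A : {set 'I_N.+1}) : seq nat :=
  [seq (val a + val b)%N | a <- enum A, b <- enum A].

Definition num_missing (N : nat) (A : {set 'I_N.+1}) : nat :=
  #|[set n : 'I_N.+1 | val n \notin sumset A]|.

Definition no_two_ones (k : nat) (w : {ffun 'I_k -> bool}) : bool :=
  [forall i : 'I_k, forall j : 'I_k,
     (val j == (val i).+1) ==> ~~ (w i && w j)].

Definition a_ (R : realType) (p : R) (k : nat) : R :=
  bits_prob p (@no_two_ones k).

Definition EY2 (R : realType) (p : R) (N : nat) : R :=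
  bits_expect p (fun w : {ffun 'I_N.+1 -> bool} =>
    ((num_missing (random_set w))%:R : R) ^+ 2).

Definition summand (R : realType) (p : R) (l : nat) : R :=
  (a_ p (2 * l) + (1 - p) * a_ p l.-1 + (1 - p) * a_ p l * a_ p (2 * l)
     + (1 - p) ^+ 2 * a_ p l * a_ p l.-1)
  / ((1 - a_ p (2 * l + 2)) * (1 - a_ p (2 * l))).

Lemma a_0 (R : realType) (p : R) : a_ p 0 = 1.
Proof.
rewrite /a_ /bits_prob (big_pred1 [ffun=> false]) /bits_weight ?big_ord0 //.
move=> w /=; have -> : (w == [ffun=> false]) by apply/eqP/ffunP => -[].
by apply/forallP => -[].
Qed.

(* Main.v *)
Require Import Defs.
From mathcomp Require Import all_boot all_order all_algebra.
From mathcomp Require Import all_classical all_reals all_analysis.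
From mathcomp Require Import ring lra zify.
Import Order.TTheory GRing.Theory Num.Theory.
Import numFieldNormedType.Exports.
Local Open Scope classical_set_scope.
Local Open Scope ring_scope.

(** Write q = 1 - p.  The second moment E[Y^2] is the sum, over all m, n <= N, of
    the probability that m and n are both missing from A + A.

    Fix m < n and put d = n - m.  Join i and j when i + j is m or n; then m and n
    are both missing exactly when no edge (or loop) lies inside A.  The composite
    of the reflections i |-> m - i and i |-> n - i is a translation by d, so the
    connected components of this graph are unions of residue classes mod d, the
    class of c being paired with that of n - c.  Two distinct paired classes
    of s elements each form a path with 2s vertices, which contributes the
    probability a_(2s) ([class_avoid_pair]).  A class of s elements paired with
    itself forms a path with s vertices whose last vertex is fixed by one of the
    two reflections: that vertex must be outside A and the s - 1 others form
    a path, which contributes q a_(s-1) ([class_avoid_loop]).  Different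
    components are independent.

    If n + 1 = l d + u with u < d, the classes 0, ..., u - 1 have l + 1 elements and
    the v = d - u others have l.  Each of these two blocks of classes is reversed by
    the pairing, so it splits into pairs, plus one self-paired class
    when its length is odd.  The probability is therefore
    F_(l+1)(u) F_l(v), where F_s(k) is a_(2s)^(k/2) for even k and
    a_(2s)^((k-1)/2) q a_(s-1) for odd k ([avoid_prob]).  The same formula
    with d = n + 1 gives the probability F_1(n+1) that n alone is missing, so that
    E[Y^2] = 2 T(N) - D(N), where T(N) adds these products over 1 <= d <= n + 1 <= N + 1
    and D(N) is the part of T(N) with d = n + 1 ([EY2E]).

    The pairs (n + 1, d) correspond bijectively to the triples (l, u, v) with l, v >= 1
    and u >= 0.  All terms are nonnegative, so T(N) converges to the sum over
    all triples ([cvg_pair_sum]).  For fixed l the sums over u and v are geometric and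
    independent, and their product is the l-th summand; the sum over l converges
    because a_k decays exponentially.  Finally D(N) tends to the sum of the
    F_1(v) over v >= 1, which is 2/p^2 - 1/p - 1. *)

(** * Product measures on bits, and the numbers a_k *)

Definition determined_by {T : Type} {I : finType} (A : {set I})
    (X : {ffun I -> bool} -> T) : Prop :=
  forall w w' : {ffun I -> bool}, {in A, w =1 w'} -> X w = X w'.

Lemma bits_probE {R : realType} {I : finType} (p : R) (E : pred {ffun I -> bool}) :
  bits_prob p E = bits_expect p (fun w => (E w)%:R).
Proof.
rewrite /bits_prob /bits_expect big_mkcond; apply: eq_bigr => w _.
by case: (E w); rewrite ?mulr1 ?mulr0.
Qed.

Lemma eq_bits_expect {R : realType} {I : finType} (p : R) (X Y : {ffun I -> bool} -> R) :
  X =1 Y -> bits_expect p X = bits_expect p Y.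
Proof. by move=> XY; apply: eq_bigr => w _; rewrite XY. Qed.

Lemma bits_expect_prod {R : realType} {I : finType} (p : R) (F : I -> bool -> R) :
  bits_expect p (fun w => \prod_i F i (w i))
  = \prod_i (p * F i true + (1 - p) * F i false).
Proof.
transitivity (\prod_i \sum_(b : bool) (if b then p else 1 - p) * F i b).
  rewrite bigA_distr_bigA; apply: eq_bigr => w _.
  by rewrite /bits_weight -big_split.
by apply: eq_bigr => i _; rewrite big_bool.
Qed.

Lemma bits_expect1 {R : realType} {I : finType} (p : R) :
  bits_expect p (fun _ : {ffun I -> bool} => 1) = 1.
Proof.
transitivity (bits_expect p (fun w : {ffun I -> bool} => \prod_(i : I) (1 : R))).
  by apply: eq_bits_expect => w; rewrite big1_eq.
rewrite (bits_expect_prod p (fun _ _ => 1)) big1 // => i _; ring.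
Qed.

(** Independence.  The product of the two expectations is an expectation over two
    independent samples [w] and [w']; exchanging their coordinates outside [A] preserves
    the product weight and makes [X] and [Y] depend on the same sample. *)
Lemma bits_expectM {R : realType} {I : finType} (p : R) (A : {set I})
    (X Y : {ffun I -> bool} -> R) :
  determined_by A X -> determined_by (~: A) Y ->
  bits_expect p (fun w => X w * Y w) = bits_expect p X * bits_expect p Y.
Proof.
move=> hX hY; rewrite -[LHS]mulr1 -(@bits_expect1 R I p) /bits_expect.
rewrite !big_distrlr /= !pair_big /=.
(* [swap] exchanges the coordinates outside [A] between the two samples. *)
pose mix (w w' : {ffun I -> bool}) := 
    [ffun i => if i \in A then w i else w' i] : {ffun I -> bool}.
pose swap (ww : {ffun I -> bool} * {ffun I -> bool}) :=
  (mix ww.1 ww.2, mix ww.2 ww.1).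
have swapK : involutive swap.
  by move=> [w w']; rewrite /swap /=; congr (_, _);
    apply/ffunP => i; rewrite !ffunE; case: (i \in A).
rewrite [RHS](reindex_inj (inv_inj swapK)); apply: eq_bigr => -[w w'] _ /=.
have -> : X (mix w w') = X w by apply: hX => i iA; rewrite ffunE iA.
have -> : Y (mix w' w) = Y w.
  by apply: hY => i; rewrite inE ffunE => /negbTE ->.
have -> : bits_weight p (mix w w') * X w * (bits_weight p (mix w' w) * Y w)
   = (bits_weight p (mix w w') * bits_weight p (mix w' w)) * (X w * Y w) by ring.
have -> : bits_weight p (mix w w') * bits_weight p (mix w' w)
   = bits_weight p w * bits_weight p w'.
  rewrite /bits_weight -!big_split; apply: eq_bigr => i _ /=; rewrite !ffunE.
  by case: (i \in A) => //; rewrite mulrC.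
ring.
Qed.

Lemma bits_expect_bigprod {R : realType} {I : finType} (p : R) {J : eqType} (s : seq J)
    (A : J -> {set I}) (X : J -> {ffun I -> bool} -> R) :
  uniq s ->
  {in s &, forall c c' i, i \in A c -> i \in A c' -> c = c'} ->
  {in s, forall c, determined_by (A c) (X c)} ->
  bits_expect p (fun w => \prod_(c <- s) X c w) = \prod_(c <- s) bits_expect p (X c).
Proof.
elim: s => [|c s IHs] /=; first by rewrite big_nil -[RHS](@bits_expect1 R I p) =>
  _ _ _; apply: eq_bits_expect => w; rewrite big_nil.
move=> /andP[cs us] disjA detX; rewrite big_cons -IHs //; first last.
- by move=> c' c's; apply: detX; rewrite inE c's orbT.
- by move=> c1 c2 c1s c2s; apply: disjA; rewrite inE ?c1s ?c2s orbT.
rewrite -(@bits_expectM _ _ _ (A c)).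
- by apply: eq_bits_expect => w; rewrite big_cons.
- by apply: detX; rewrite mem_head.
move=> w w' ww'; apply: eq_big_seq => c' c's.
have c'cs : c' \in c :: s by rewrite inE c's orbT.
apply: (detX _ c'cs) => i iA'; apply: ww'.
rewrite inE; apply/negP => iA; have e := disjA _ _ (mem_head c s) c'cs _ iA iA'.
by move: cs; rewrite e c's.
Qed.

(** The marginal law along an injective map is again a product law: summing out a
    coordinate that is not in the image of [g] gives the factor p + (1 - p) = 1. *)
Lemma bits_expect_comp {R : realType} {I J : finType} (p : R) (g : J -> I)
    (X : {ffun J -> bool} -> R) :
  injective g ->
  bits_expect p (fun w : {ffun I -> bool} => X [ffun j => w (g j)])
  = bits_expect p X.
Proof.
move=> g_inj.
transitivity (\sum_(v : {ffun J -> bool}) X v *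
   bits_expect p (fun w : {ffun I -> bool} => \prod_j (w (g j) == v j)%:R)).
  rewrite /bits_expect; under [RHS]eq_bigr do rewrite big_distrr /=.
  rewrite exchange_big; apply: eq_bigr => w _ /=.
  rewrite (bigD1 [ffun j => w (g j)]) //= [X in _ + X]big1 => [|v nv].
    rewrite big1 => [|j _]; last by rewrite ffunE eqxx.
    by rewrite mulr1 addr0 mulrC.
  have [j jP] : exists j, w (g j) != v j.
    apply/existsP; rewrite -negb_forall; apply: contra nv => /forallP h.
    by apply/eqP/ffunP => j; rewrite ffunE (eqP (h j)).
  by rewrite (bigD1 j) //= (negbTE jP) mul0r !mulr0.
apply: eq_bigr => v _; rewrite mulrC; congr (_ * _).
transitivity (bits_expect p (fun w : {ffun I -> bool} =>
    \prod_i \prod_(j | g j == i) (w i == v j)%:R)).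
  apply: eq_bits_expect => w; rewrite (partition_big g xpredT) //=.
  by apply: eq_bigr => i _; apply: eq_bigr => j /eqP <-.
rewrite (bits_expect_prod p (fun i b => \prod_(j | g j == i) (b == v j)%:R)).
rewrite /bits_weight [RHS](partition_big g xpredT) //=.
apply: eq_bigr => i _.
case: (pickP (fun j => g j == i)) => [j /eqP gj|none]; last first.
  by rewrite !big_pred0 //; ring.
have gE k : (g k == i) = (k == j) by rewrite -gj (inj_eq g_inj).
under eq_bigl do rewrite gE; under [X in _ + _ * X]eq_bigl do rewrite gE.
under [RHS]eq_bigl do rewrite gE; rewrite !big_pred1_eq.
by case: (v j) => /=; ring.
Qed.

Lemma bits_weight_ge0 {R : realType} {I : finType} (p : R) (w : {ffun I -> bool}) :
  0 <= p <= 1 -> 0 <= bits_weight p w.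
Proof.
by case/andP=> p0 p1; apply: prodr_ge0 => i _; case: ifP => _; rewrite ?subr_ge0.
Qed.

Lemma ler_bits_expect {R : realType} {I : finType} (p : R) (X Y : {ffun I -> bool} -> R) :
  0 <= p <= 1 -> (forall w, X w <= Y w) -> bits_expect p X <= bits_expect p Y.
Proof.
move=> p01 XY; apply: ler_sum => w _.
by apply: ler_wpM2l; rewrite ?bits_weight_ge0.
Qed.

Lemma bits_expect_coord {R : realType} {I : finType} (p : R) (i : I) :
  bits_expect p (fun w : {ffun I -> bool} => (~~ w i)%:R) = 1 - p.
Proof.
transitivity (bits_expect p (fun w : {ffun I -> bool} =>
   \prod_j (if j == i then (~~ w j)%:R else 1 : R))).
  by apply: eq_bits_expect => w; rewrite -big_mkcond big_pred1_eq.
rewrite (bits_expect_prod p (fun j b => if j == i then (~~ b)%:R else 1)).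
rewrite (bigD1 i) //= eqxx big1 => [|j /negbTE ->]; by [rewrite /=; ring|ring].
Qed.

Lemma a_E {R : realType} (p : R) k :
  a_ p k = bits_expect p (fun w => (@no_two_ones k w)%:R).
Proof. exact: bits_probE. Qed.

Lemma no_two_onesP {k} (w : {ffun 'I_k -> bool}) :
  reflect (forall i j : 'I_k, val j = (val i).+1 -> ~~ (w i && w j)) (no_two_ones w).
Proof.
apply: (iffP forallP) => h i; last first.
  by apply/forallP => j; apply/implyP => /eqP; apply: h.
by move=> j /eqP ji; move: (forallP (h i) j); rewrite ji.
Qed.

Lemma a_ge0 {R : realType} (p : R) k : 0 <= p <= 1 -> 0 <= a_ p k.
Proof.
move=> p01; rewrite a_E; apply: sumr_ge0 => w _.
by rewrite mulr_ge0 ?bits_weight_ge0.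
Qed.

(** Cut a string after [j] entries: its two parts are independent, and neither has two
    consecutive ones if the whole string has none. *)
Lemma a_leD {R : realType} (p : R) j k : 0 <= p <= 1 ->
  a_ p (j + k) <= a_ p j * a_ p k.
Proof.
move=> p01; rewrite !a_E.
rewrite -(@bits_expect_comp _ _ _ p (@lshift j k)); last exact: lshift_inj.
rewrite -(@bits_expect_comp _ _ _ p (@rshift j k)); last exact: rshift_inj.
rewrite -(@bits_expectM _ _ _ [set i : 'I_(j + k) | (i < j)%N]); first last.
- move=> w w' ww'; congr ((no_two_ones _)%:R); apply/ffunP => i; rewrite !ffunE.
  by apply: ww'; rewrite !inE /= ltnNge leq_addr.
- move=> w w' ww'; congr ((no_two_ones _)%:R); apply/ffunP => i; rewrite !ffunE.
  by apply: ww'; rewrite !inE /=.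
apply: ler_bits_expect => // w.
case: no_two_onesP => [h|_]; last by rewrite mulr_ge0.
have -> : no_two_ones [ffun i => w (lshift k i)].
  by apply/no_two_onesP => i i' e; rewrite !ffunE; apply: h.
have -> : no_two_ones [ffun i => w (rshift j i)]; last by rewrite mulr1.
by apply/no_two_onesP => i i' e; rewrite !ffunE; apply: h; rewrite /= e addnS.
Qed.

Lemma a_le1 {R : realType} (p : R) k : 0 <= p <= 1 -> a_ p k <= 1.
Proof.
move=> p01; rewrite a_E -[leRHS](@bits_expect1 R 'I_k p).
by apply: ler_bits_expect => // w; case: no_two_ones.
Qed.

Lemma a_antitone {R : realType} (p : R) j k : 0 <= p <= 1 ->
  (j <= k)%N -> a_ p k <= a_ p j.
Proof.
move=> p01 /subnKC <-; apply: le_trans (a_leD _ _ _ p01) _.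
by rewrite ler_piMr ?a_ge0 ?a_le1.
Qed.

Lemma a_2 {R : realType} (p : R) : a_ p 2 = 1 - p ^+ 2.
Proof.
rewrite a_E -[X in X - _](@bits_expect1 R 'I_2 p).
have -> : p ^+ 2 = bits_expect p (fun w : {ffun 'I_2 -> bool} => \prod_i (w i)%:R).
  rewrite (bits_expect_prod p (fun _ b => b%:R)) prodr_const card_ord; congr (_ ^+ _).
  by rewrite /=; ring.
rewrite /bits_expect -sumrB; apply: eq_bigr => w _.
rewrite -mulrBr; congr (_ * _); rewrite big_ord_recl big_ord1.
have -> : no_two_ones w = ~~ (w ord0 && w (lift ord0 ord0)).
  apply/no_two_onesP/idP => [|h i j ji]; first exact.
  have -> : i = ord0 by apply: val_inj; move: ji (ltn_ord j) => /=; lia.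
  have -> // : j = lift ord0 ord0.
  by apply: val_inj; move: ji (ltn_ord j) => /=; rewrite /bump /=; lia.
by case: (w _); case: (w _) => /=; ring.
Qed.

(** Exponential decay of [a_], which makes the series of the theorem converge. *)
Lemma a_le_expr {R : realType} (p : R) k : 0 <= p <= 1 ->
  a_ p k <= a_ p 2 ^+ k./2.
Proof.
move=> p01; have [n] := ubnP k; elim: n k => // n IH [|[|k]] kn.
- by rewrite expr0 a_le1.
- by rewrite expr0 a_le1.
rewrite -(addn2 k) halfD /= andbF addn1 exprSr.
apply: le_trans (a_leD _ _ _ p01) _.
by apply: ler_wpM2r; [exact: a_ge0 | apply: IH; lia].
Qed.

Lemma a_lt1 {R : realType} (p : R) l : 0 < p < 1 -> (0 < l)%N -> a_ p (2 * l) < 1.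
Proof.
move=> /andP[p0 p1] l0; apply: (@le_lt_trans _ _ (a_ p 2)).
  by apply: a_antitone; [rewrite !ltW | lia].
by rewrite a_2 ltrBlDr ltrDl exprn_gt0.
Qed.

(** * Paths formed by one residue class and its mirror image *)

(** With m = n - d, the numbers [i] and [j] are linked when their sum is n or m.  This
    form makes sense for d = n + 1, where the second condition cannot hold and only
    the sum n is forbidden. *)
Definition linked (n d i j : nat) : bool := ((i + j == n) || (i + j + d == n))%N.

Lemma linkedC (n d i j : nat) : linked n d i j = linked n d j i.
Proof. by rewrite /linked (addnC i). Qed.

Definition class_avoid (N n d c : nat) (w : {ffun 'I_N.+1 -> bool}) : bool :=
  [forall i : 'I_N.+1, forall j : 'I_N.+1,
     (i %% d == c)%N && linked n d i j ==> ~~ (w i && w j)].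

(** Numbering of the path formed by the classes of [c] and [c'] mod [d], with [s] elements
    each, when n = c + c' + d (s - 1): start at the largest element of the class of [c'] and
    apply alternately i |-> n - i and i |-> (n - d) - i.  Odd positions go up the
    class of [c], even positions go down the class of [c']. *)
Definition walk (d s c c' i : nat) : nat :=
  (if odd i then c + d * i./2 else c' + d * (s.-1 - i./2))%N.

Lemma walk_double (d s c c' t : nat) : walk d s c c' t.*2 = (c' + d * (s.-1 - t))%N.
Proof. by rewrite /walk odd_double doubleK. Qed.

Lemma walk_doubleS (d s c c' t : nat) : walk d s c c' t.*2.+1 = (c + d * t)%N.
Proof. by rewrite /walk /= odd_double /= uphalf_double. Qed.

Lemma walk_mod (d s c c' i : nat) : (c < d)%N -> (c' < d)%N ->
  (walk d s c c' i %% d)%N = if odd i then c else c'.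
Proof. by move=> cd c'd; rewrite /walk; case: odd; rewrite addnC mulnC modnMDl modn_small. Qed.

Lemma walk_le (d s c c' i : nat) : (i < 2 * s)%N ->
  (walk d s c c' i <= c + c' + d * s.-1)%N.
Proof.
move=> is_; rewrite /walk; case: ifP => oi.
  by rewrite addnAC; apply: leq_trans (leq_addr _ _);
    rewrite leq_add2l leq_mul2l; apply/orP; right; lia.
by rewrite leq_add ?leq_addl // leq_mul2l leq_subr orbT.
Qed.

Lemma walk_inj (d s c c' i j : nat) : (c < d)%N -> (c' < d)%N ->
  (i < 2 * s)%N -> (j < 2 * s)%N -> odd i = odd j ->
  walk d s c c' i = walk d s c c' j -> i = j.
Proof.
move=> cd c'd is_ js oij; rewrite /walk -oij.
have d0 : (0 < d)%N by lia.
case: ifP => oi /addnI /eqP; rewrite eqn_mul2l => /orP[/eqP|/eqP]; lia.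
Qed.

Lemma walk_linked (d s c c' i : nat) : (i.+1 < 2 * s)%N ->
  linked (c + c' + d * s.-1) d (walk d s c c' i) (walk d s c c' i.+1).
Proof.
rewrite -(odd_double_half i); case: (odd i) => /=; rewrite ?add0n ?add1n => is_.
  rewrite -doubleS walk_double walk_doubleS /linked; apply/orP; right; apply/eqP.
  have -> : (s.-1 = (s.-1 - i./2.+1) + i./2 + 1)%N by lia.
  by rewrite !mulnDr muln1; lia.
rewrite walk_double walk_doubleS /linked; apply/orP; left; apply/eqP.
have e : (s.-1 = (s.-1 - i./2) + i./2)%N by lia.
by rewrite {2}e !mulnDr; lia.
Qed.

(** Every edge at a vertex of the class of [c] is a step of the walk: the vertex c + d t
    has position 2t + 1, its neighbour of sum n comes just before and its
    neighbour of sum n - d just after. *)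
Lemma linked_walk (d s c c' i j : nat) :
  (c < d)%N -> (c' < d)%N -> (0 < s)%N ->
  (i %% d)%N = c -> linked (c + c' + d * s.-1) d i j ->
  exists2 k, (k.+1 < 2 * s)%N &
    (i = walk d s c c' k.+1 /\ j = walk d s c c' k) \/
    (i = walk d s c c' k /\ j = walk d s c c' k.+1).
Proof.
move=> cd c'd s0 ic; rewrite (divn_eq i d) ic; set t := (i %/ d)%N.
have lt_d x y : (d * x <= c' + d * y -> x <= y)%N.
  move=> h; rewrite leqNgt; apply/negP => yx.
  have : (d * y.+1 <= d * x)%N by rewrite leq_mul2l yx orbT.
  by rewrite mulnS; lia.
case/orP => /eqP ij.
  have ts : (t <= s.-1)%N by apply: lt_d; rewrite mulnC; lia.
  exists t.*2; first by lia.
  left; rewrite walk_double walk_doubleS; split; first by rewrite mulnC addnC.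
  by move: ij; rewrite -{1}(subnK ts) mulnDr; lia.
have ts : (t.+1 <= s.-1)%N by apply: lt_d; rewrite mulnS mulnC; lia.
exists t.*2.+1; first by lia.
right; rewrite -doubleS walk_double walk_doubleS; split; first by rewrite mulnC addnC.
by move: ij; rewrite -{1}(subnK ts) mulnDr mulnS; lia.
Qed.

(** For a self-paired class the walk visits every vertex twice, the second time in
    reverse order. *)
Lemma walk_fold (d s c k : nat) : (k < 2 * s)%N ->
  walk d s c c (2 * s - k.+1) = walk d s c c k.
Proof.
move=> ks; rewrite -(odd_double_half k); move: (k./2) (odd_double_half k) => t.
case: (odd k) => /= kE; rewrite ?add0n ?add1n.
  have -> : (2 * s - t.*2.+2 = (s - t.+1).*2)%N by lia.
  rewrite walk_double walk_doubleS; congr (_ + _ * _)%N; lia.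
have -> : (2 * s - t.*2.+1 = (s - t.+1).*2.+1)%N by lia.
rewrite walk_double walk_doubleS; congr (_ + _ * _)%N; lia.
Qed.

Lemma class_avoidP (N d s c c' : nat) (w : {ffun 'I_N.+1 -> bool}) :
  (c < d)%N -> (c' < d)%N -> (0 < s)%N -> (c + c' + d * s.-1 <= N)%N ->
  reflect (forall k, (k.+1 < 2 * s)%N ->
             ~~ (w (inord (walk d s c c' k)) && w (inord (walk d s c c' k.+1))))
    (class_avoid N (c + c' + d * s.-1) d c w).
Proof.
move=> cd c'd s0 nN.
have walkN k : (k < 2 * s)%N -> (walk d s c c' k < N.+1)%N.
  by move=> ks; rewrite ltnS; apply: leq_trans nN; apply: walk_le.
apply: (iffP forallP) => [h k ks|h i].
  have := walk_linked d s c c' k ks; have mk := walk_mod d s c c' _ cd c'd.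
  case ok : (odd k) => lk.
    have /forallP/(_ (inord (walk d s c c' k.+1))) := h (inord (walk d s c c' k)).
    by rewrite !inordK ?walkN // 1?ltnW // mk ok eqxx lk.
  have /forallP/(_ (inord (walk d s c c' k))) := h (inord (walk d s c c' k.+1)).
  rewrite !inordK ?walkN // 1?ltnW // mk /= ok eqxx /=.
  by rewrite linkedC lk andbC.
apply/forallP => j; apply/implyP => /andP[/eqP ic ij].
have [k ks ijE] := linked_walk _ _ _ _ _ _ cd c'd s0 ic ij.
rewrite -(inord_val i) -(inord_val j).
by case: ijE => -[-> ->]; [rewrite andbC|]; apply: h.
Qed.

Lemma class_avoid_pair {R : realType} (p : R) (N d s c c' : nat) :
  (c < d)%N -> (c' < d)%N -> (0 < s)%N -> (c + c' + d * s.-1 <= N)%N -> c != c' ->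
  bits_expect p (fun w => (class_avoid N (c + c' + d * s.-1) d c w)%:R)
  = a_ p (2 * s).
Proof.
move=> cd c'd s0 nN cc'.
have walkN k : (k < 2 * s)%N -> (walk d s c c' k < N.+1)%N.
  by move=> ks; rewrite ltnS; apply: leq_trans nN; apply: walk_le.
pose g (k : 'I_(2 * s)) : 'I_N.+1 := inord (walk d s c c' k).
have g_inj : injective g.
  move=> i j /(congr1 (@nat_of_ord _)); rewrite /g !inordK ?walkN // => e.
  apply: val_inj; apply: (walk_inj _ _ _ _ _ _ cd c'd _ _ _ e) => //=.
  move: (congr1 (modn^~ d) e); rewrite /= !walk_mod //.
  by move: cc'; do 2 case: odd => //; move=> /eqP + e'; rewrite e'.
rewrite a_E -(@bits_expect_comp _ _ _ _ g) //; apply: eq_bits_expect => w.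
congr ((_ : bool)%:R); apply/class_avoidP/no_two_onesP => // [h i j ji|h k ks].
  rewrite /= in ji; by rewrite !ffunE /g ji; apply: h; rewrite -ji.
by have := h (Ordinal (ltnW ks)) (Ordinal ks) erefl; rewrite !ffunE.
Qed.

(** Here only the first [s] positions of the walk are distinct.  The step from position
    s - 1 to position s is a loop, by [walk_fold], and it excludes the
    vertex at position s - 1 from the set; later steps repeat earlier ones. *)
Lemma class_avoid_loop {R : realType} (p : R) (N d s c : nat) :
  (c < d)%N -> (0 < s)%N -> (c + c + d * s.-1 <= N)%N ->
  bits_expect p (fun w => (class_avoid N (c + c + d * s.-1) d c w)%:R)
  = (1 - p) * a_ p s.-1.
Proof.
move=> cd s0 nN.
have walkN k : (k < 2 * s)%N -> (walk d s c c k < N.+1)%N.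
  by move=> ks; rewrite ltnS; apply: leq_trans nN; apply: walk_le.
(* If the parities differ, [walk_inj] applies to [i] and to the mirror image 2s - 1 - j,
   where the walk takes the same value; but that position is not below [s]. *)
have inj_s i j : (i < s)%N -> (j < s)%N -> walk d s c c i = walk d s c c j -> i = j.
  move=> is_ js e; case: (eqVneq (odd i) (odd j)) => oij.
    by apply: (walk_inj _ _ _ _ _ _ cd cd _ _ oij e); lia.
  suff : i = (2 * s - j.+1)%N by lia.
  by apply: (walk_inj d s c c _ _ cd cd); [lia..| rewrite walk_fold; lia].
pose g (k : 'I_s.-1) : 'I_N.+1 := inord (walk d s c c k).
have g_inj : injective g.
  move=> i j /(congr1 (@nat_of_ord _)); have := ltn_ord i; have := ltn_ord j.
  move=> js is_; rewrite /g !inordK ?walkN //; try lia.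
  by move=> e; apply: val_inj; apply: (inj_s _ _ _ _ e); lia.
pose z : 'I_N.+1 := inord (walk d s c c s.-1).
rewrite a_E -(@bits_expect_comp _ _ _ _ g) // -(@bits_expect_coord _ _ p z).
rewrite -(@bits_expectM _ _ _ [set z]); first last.
- move=> w w' ww'; congr ((no_two_ones _)%:R); apply/ffunP => k; rewrite !ffunE.
  apply: ww'; rewrite !inE; apply/eqP => /(congr1 (@nat_of_ord _)).
  have ks := ltn_ord k; rewrite /g /z !inordK ?walkN //; try lia.
  by move/inj_s; lia.
- by move=> w w' ww'; rewrite ww' ?inE.
apply: eq_bits_expect => w; rewrite -natrM mulnb; congr ((_ : bool)%:R).
apply/class_avoidP/andP => // [h|[hz /no_two_onesP h] k ks].
  split; last first.
    apply/no_two_onesP => i j /= ji; rewrite !ffunE /g ji; apply: h; move: (ltn_ord j); lia.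
  have := h s.-1; rewrite -[walk _ _ _ _ s.-1.+1]walk_fold; last by lia.
  have -> : (2 * s - s.-1.+2 = s.-1)%N by lia.
  by rewrite andbb; apply; lia.
have hs k' : (k'.+1 < s)%N ->
    ~~ (w (inord (walk d s c c k')) && w (inord (walk d s c c k'.+1))).
  move=> ks'; have k1 : (k' < s.-1)%N by lia.
  case: (ltnP k'.+1 s.-1) => k2.
    by have := h (Ordinal k1) (Ordinal k2) erefl; rewrite !ffunE.
  have -> : k'.+1 = s.-1 by lia.
  by rewrite negb_and hz orbT.
case: (ltngtP k.+1 s) => [|sk|sk]; first exact: hs.
- rewrite -(walk_fold d s c k) -?(walk_fold d s c k.+1); try lia.
  have -> : (2 * s - k.+1 = (2 * s - k.+2).+1)%N by lia.
  by rewrite andbC; apply: hs; lia.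
have -> : k = s.-1 by lia.
by rewrite negb_and hz.
Qed.

(** * The probability that two given integers are missing *)

Definition avoid (N n d : nat) (w : {ffun 'I_N.+1 -> bool}) : bool :=
  [forall i : 'I_N.+1, forall j : 'I_N.+1, linked n d i j ==> ~~ (w i && w j)].

(** The residue of n - c mod [d], when n + 1 = l d + u and u < d: the pairing reverses
    the interval [0, u) and the interval [u, d). *)
Definition mate (d u c : nat) : nat :=
  (if c < u then u.-1 - c else (d + u).-1 - c)%N.

Lemma mate_lt (d u c : nat) : (u < d)%N -> (c < d)%N -> (mate d u c < d)%N.
Proof. by rewrite /mate; case: ifP; lia. Qed.

Lemma mateK (d u c : nat) : (u < d)%N -> (c < d)%N -> mate d u (mate d u c) = c.
Proof.
move=> ud cd; rewrite {2}/mate; case: ifP => cu; rewrite /mate; case: ifP; lia.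
Qed.

(** The class of [c] in {0, ..., n} has l + 1 elements if c < u and l otherwise. *)
Lemma mate_sum (l d u c n : nat) : n.+1 = (l * d + u)%N -> (0 < l)%N ->
  (u < d)%N -> (c < d)%N -> n = (c + mate d u c + d * (l + (c < u)).-1)%N.
Proof.
move=> nE l0 ud cd; rewrite /mate; case: (ltnP c u) => cu.
  by rewrite addn1 /= mulnC; lia.
by rewrite addn0 -{1}(prednK l0) mulSn mulnC in nE *; lia.
Qed.

Lemma linked_mate (l d u n i j : nat) : n.+1 = (l * d + u)%N -> (0 < l)%N ->
  (u < d)%N -> linked n d i j -> (j %% d = mate d u (i %% d))%N.
Proof.
move=> nE l0 ud; have d0 : (0 < d)%N by lia.
have cd := ltn_pmod i d0; have c'd := mate_lt _ _ _ ud cd.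
rewrite {1}(mate_sum _ _ _ _ _ nE l0 ud cd) => ij.
have s0 : (0 < l + (i %% d < u))%N by lia.
have [k _] := linked_walk _ _ _ _ _ _ cd c'd s0 erefl ij.
have mk := walk_mod d (l + (i %% d < u)) _ _ _ cd c'd.
by case=> -[/(congr1 (modn^~ d)) /= + ->]; rewrite !mk /=; case: odd.
Qed.

Lemma natr_all {R : realType} {T : Type} (a : pred T) (s : seq T) :
  (all a s)%:R = \prod_(x <- s) (a x)%:R :> R.
Proof.
elim: s => [|x s IH]; first by rewrite big_nil.
by rewrite big_cons -IH /= -natrM mulnb.
Qed.

(** One representative for each pair of mutually paired residues. *)
Definition class_reps (d u : nat) : seq nat :=
  [seq c <- index_iota 0 d | (c <= mate d u c)%N].

Lemma avoid_prodE {R : realType} (N l d u n : nat) (w : {ffun 'I_N.+1 -> bool}) :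
  n.+1 = (l * d + u)%N -> (0 < l)%N -> (u < d)%N ->
  (avoid N n d w)%:R
  = \prod_(c <- class_reps d u) (class_avoid N n d c w)%:R :> R.
Proof.
move=> nE l0 ud; have d0 : (0 < d)%N by lia.
rewrite -natr_all; congr ((_ : bool)%:R).
apply/forallP/allP => [h c|h i].
  rewrite mem_filter => _; apply/forallP => i; apply/forallP => j.
  by apply/implyP => /andP[_ ij]; move: (forallP (h i) j); rewrite ij.
apply/forallP => j; apply/implyP => ij.
(* It is enough to use the end of an edge whose residue is a representative. *)
have useclass (i' j' : 'I_N.+1) : linked n d i' j' ->
    (i' %% d <= mate d u (i' %% d))%N -> ~~ (w i' && w j').
  move=> ij' le; have /h/forallP/(_ i')/forallP/(_ j') :
      (i' %% d)%N \in class_reps d u.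
    by rewrite mem_filter le mem_index_iota ltn_pmod.
  by rewrite eqxx ij'.
case: (leqP (i %% d) (mate d u (i %% d))) => [|lt_mate]; first exact: useclass.
rewrite andbC; apply: useclass; first by rewrite linkedC.
by rewrite (linked_mate _ _ _ _ _ _ nE l0 ud ij) mateK ?ltn_pmod // ltnW.
Qed.

Lemma class_avoid_determined {R : realType} (N l d u n c : nat) :
  n.+1 = (l * d + u)%N -> (0 < l)%N -> (u < d)%N ->
  determined_by [set i : 'I_N.+1 | (i %% d == c)%N || (i %% d == mate d u c)%N]
    (fun w => (class_avoid N n d c w)%:R : R).
Proof.
move=> nE l0 ud w w' ww'; congr ((_ : bool)%:R).
apply: eq_forallb => i; apply: eq_forallb => j.
case: eqP => //= ic; case ij: (linked n d i j) => //=.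
rewrite !ww' // inE ?ic ?eqxx //.
by rewrite (linked_mate _ _ _ _ _ _ nE l0 ud ij) ic eqxx orbT.
Qed.

(** The contribution of a block of [k] consecutive residues, each with a class of [s]
    elements, that the pairing reverses. *)
Definition block_factor {R : realType} (p : R) (s k : nat) : R :=
  a_ p (2 * s) ^+ k./2 * ((1 - p) * a_ p s.-1) ^+ odd k.

(** The reflection c |-> k - 1 - c has k / 2 orbits with two elements, and a fixed
    point exactly when [k] is odd; the inequality selects the smaller element
    of each orbit. *)
Lemma prod_reflection {R : realType} (A B : R) (k : nat) :
  \prod_(0 <= c < k | (c <= k.-1 - c)%N) (if (c == k.-1 - c)%N then B else A)
  = A ^+ k./2 * B ^+ odd k.
Proof.
have [n] := ubnP k; elim: n k => // n IH [|[|k]] kn.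
- by rewrite big_geq // mul1r.
- by rewrite big_mkcond big_nat1 /= mul1r.
rewrite big_mkcond big_nat_recl //= big_nat_recr //= subnn.
rewrite ltn0 mulr1 negbK exprS -mulrA -IH; last by lia.
congr (_ * _); rewrite [RHS]big_mkcond !big_nat; apply: eq_bigr => c /andP[_ ck].
have -> : (k.+1 - c.+1 = (k.-1 - c).+1)%N by lia.
by rewrite eqSS ltnS.
Qed.

Lemma avoid_prob {R : realType} (p : R) (N l d u n : nat) :
  n.+1 = (l * d + u)%N -> (0 < l)%N -> (u < d)%N -> (n <= N)%N ->
  bits_expect p (fun w => (avoid N n d w)%:R)
  = block_factor p l.+1 u * block_factor p l (d - u).
Proof.
move=> nE l0 ud nN.
under eq_bits_expect do rewrite (avoid_prodE _ _ _ _ _ _ nE l0 ud).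
rewrite (@bits_expect_bigprod _ _ _ _ _
  (fun c => [set i : 'I_N.+1 | (i %% d == c)%N || (i %% d == mate d u c)%N]%SET));
  first last.
- by move=> c _; apply: class_avoid_determined nE l0 ud.
- move=> c c'; rewrite !mem_filter !mem_index_iota /= => /andP[cm cd] /andP[cm' cd'] i.
  rewrite !inE => h h'.
  (* Each residue is at most its mate, so two mates are equal. *)
  suff: c = c' \/ (c = mate d u c' /\ c' = mate d u c) by lia.
  have mK := mateK d u _ ud.
  move: h h' => /orP[]/eqP-> /orP[]/eqP; [by left|move=> e|move=> e|move=> e].
  + by right; split; rewrite // e mK.
  + by right; split; rewrite // -e mK.
  + by left; rewrite -(mK c) // e mK.
- exact/filter_uniq/iota_uniq.
pose F c := if (c == mate d u c)%N then (1 - p) * a_ p (l + (c < u)).-1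
   else a_ p (2 * (l + (c < u))).
transitivity (\prod_(c <- class_reps d u) F c).
  apply: eq_big_seq => c; rewrite mem_filter mem_index_iota /= => /andP[_ cd].
  have s0 : (0 < l + (c < u))%N by lia.
  rewrite /F; case: eqP => [e|/eqP ne].
    have nE' := mate_sum _ _ _ _ _ nE l0 ud cd; rewrite -e in nE'.
    by rewrite nE' class_avoid_loop // -nE'.
  have nE' := mate_sum _ _ _ _ _ nE l0 ud cd.
  by rewrite {1}nE' class_avoid_pair ?mate_lt // -nE'.
rewrite big_filter (big_cat_nat _ (ltnW ud)) //=; congr (_ * _).
  rewrite /block_factor -prod_reflection big_nat_cond [RHS]big_nat_cond.
  apply: eq_big => [c|c /andP[cu _]]; rewrite /F /mate; first by case: ltnP.
  by rewrite (andP cu).2 addn1.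
rewrite /block_factor -prod_reflection -{1}[u]add0n big_addn big_nat_cond [RHS]big_nat_cond.
apply: eq_big => [c|c /andP[cu _]].
  by rewrite /F /mate ifN; lia.
rewrite /F /mate; have -> : (c + u < u)%N = false by lia.
rewrite addn0; have -> // : (c + u == (d + u).-1 - (c + u))%N = (c == (d - u).-1 - c)%N.
by apply/eqP/eqP; lia.
Qed.

(** * The second moment as a finite double sum *)

Lemma avoidP (N n d : nat) (w : {ffun 'I_N.+1 -> bool}) :
  reflect (forall i j : 'I_N.+1, linked n d i j -> ~~ (w i && w j)) (avoid N n d w).
Proof.
apply: (iffP forallP) => h i; last by apply/forallP => j; apply/implyP; apply: h.
by move=> j ij; move: (forallP (h i) j); rewrite ij.
Qed.

Lemma notin_sumset (N : nat) (n : 'I_N.+1) (w : {ffun 'I_N.+1 -> bool}) :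
  (val n \notin sumset (random_set w)) = avoid N n n.+1 w.
Proof.
apply/idP/avoidP => [/allpairsP nn i j ij|h].
  apply/negP => /andP[wi wj]; apply: nn; exists (i, j).
  by rewrite !mem_enum !inE; split=> //=; move: ij; rewrite /linked; lia.
apply/allpairsP => -[[i j]]; rewrite !mem_enum !inE /= => -[wi wj nE].
by have := h i j; rewrite wi wj /linked nE eqxx => /(_ isT).
Qed.

Lemma num_missingE {R : realType} (N : nat) (w : {ffun 'I_N.+1 -> bool}) :
  (num_missing (random_set w))%:R = \sum_(0 <= n < N.+1) (avoid N n n.+1 w)%:R :> R.
Proof.
rewrite /num_missing -sum1_card natr_sum big_mkcond big_mkord.
by apply: eq_bigr => n _; rewrite inE notin_sumset; case: avoid.
Qed.

Lemma avoid_both (N m n : nat) (w : {ffun 'I_N.+1 -> bool}) : (m < n)%N ->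
  avoid N n n.+1 w && avoid N m m.+1 w = avoid N n (n - m) w.
Proof.
move=> mn; apply/andP/avoidP => [[/avoidP hn /avoidP hm] i j|h].
  rewrite /linked => /orP[ij|ij]; first by apply: hn; rewrite /linked ij.
  by apply: hm; rewrite /linked; lia.
by split; apply/avoidP => i j; rewrite /linked => ij; apply: h; rewrite /linked; lia.
Qed.

Lemma sum_symmetric {R : realType} (h : nat -> nat -> R) (M : nat) :
  (forall i j, h i j = h j i) ->
  \sum_(0 <= i < M) \sum_(0 <= j < M) h i j
  = \sum_(0 <= i < M) (2 * (\sum_(0 <= j < i) h i j) + h i i).
Proof.
move=> hC; elim: M => [|M IH]; first by rewrite !big_geq.
rewrite big_nat_recr //= [RHS]big_nat_recr //= -IH.
under eq_bigr do rewrite big_nat_recr //=.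
rewrite big_split /= [\sum_(0 <= j < M.+1) _]big_nat_recr //=.
under [X in _ + X + _]eq_bigr do rewrite hC.
ring.
Qed.

Definition pair_term {R : realType} (p : R) (k d : nat) : R :=
  block_factor p (k %/ d).+1 (k %% d) * block_factor p (k %/ d) (d - k %% d).

Lemma pair_termE {R : realType} (p : R) (N n d : nat) :
  (0 < d <= n.+1)%N -> (n <= N)%N ->
  bits_expect p (fun w => (avoid N n d w)%:R) = pair_term p n.+1 d.
Proof.
move=> /andP[d0 dn] nN; rewrite (@avoid_prob _ _ _ _ _ _ _ (divn_eq n.+1 d)) //.
- by rewrite divn_gt0.
- exact: ltn_pmod.
Qed.

(** The term with d = n + 1, in which n is the only integer required to be missing. *)
Lemma pair_term_diag {R : realType} (p : R) (k : nat) : (0 < k)%N ->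
  pair_term p k k = block_factor p 1 k.
Proof. by move=> k0; rewrite /pair_term divnn k0 modnn /= subn0 /block_factor /= !mul1r. Qed.

(** The terms with d = n + 1 enter E[Y^2] once and the others twice.  The double sum
    counts all of them twice, hence the correction. *)
Lemma EY2E {R : realType} (p : R) (N : nat) :
  EY2 p N = 2 * (\sum_(1 <= k < N.+2) \sum_(1 <= d < k.+1) pair_term p k d)
            - \sum_(1 <= k < N.+2) block_factor p 1 k.
Proof.
pose h m n := bits_expect p (fun w => (avoid N m m.+1 w && avoid N n n.+1 w)%:R) : R.
transitivity (\sum_(0 <= n < N.+1) \sum_(0 <= m < N.+1) h n m).
  rewrite /h /bits_expect.
  under [RHS]eq_bigr do rewrite exchange_big /=.
  rewrite exchange_big /=; apply: eq_bigr => w _.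
  rewrite num_missingE expr2 big_distrlr /= big_distrr /=.
  apply: eq_bigr => n _; rewrite big_distrr /=.
  by apply: eq_bigr => m _; rewrite -mulnb natrM.
rewrite sum_symmetric; last by move=> m n; apply: eq_bits_expect => w; rewrite andbC.
rewrite big_distrr /= -sumrB big_add1 /= big_nat [RHS]big_nat; apply: eq_bigr => n /= nN.
have -> : h n n = block_factor p 1 n.+1.
  rewrite -pair_term_diag // -(@pair_termE _ _ N) ?leqnn //.
  by apply: eq_bits_expect => w; rewrite andbb.
rewrite big_nat_recr //= pair_term_diag //.
have -> : \sum_(0 <= m < n) h n m = \sum_(1 <= d < n.+1) pair_term p n.+1 d.
  rewrite big_add1 /= big_nat_rev /= big_nat [RHS]big_nat; apply: eq_bigr => m mn.
  rewrite -(@pair_termE _ _ N) //; last by lia.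
  apply: eq_bits_expect => w; rewrite avoid_both; last by lia.
  by congr ((avoid _ _ _ _)%:R); lia.
ring.
Qed.

(** * Geometric sums *)

(** Used in both directions between pairs and triples: a finite truncation of one
    family injects into a larger truncation of the other, and no exact
    description of the image is needed. *)
Lemma ler_sum_inj {R : realType} {S T : eqType} (s : seq S) (t : seq T)
    (h : S -> T) (F : T -> R) :
  uniq s -> uniq t -> {in s &, injective h} -> {in s, forall x, h x \in t} ->
  (forall y, 0 <= F y) -> \sum_(x <- s) F (h x) <= \sum_(y <- t) F y.
Proof.
move=> us ut h_inj hst F0.
rewrite -(big_map h xpredT F) [leRHS](bigID (mem (map h s))) /= -[leLHS]addr0 lerD //.
  rewrite -[leRHS]big_filter le_eqVlt; apply/orP; left; apply/eqP/perm_big.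
  apply: uniq_perm; rewrite ?map_inj_in_uniq ?filter_uniq // => y.
  rewrite mem_filter /=; case: mapP => //= -[x xs ->]; exact/esym/hst.
exact: sumr_ge0.
Qed.

Lemma sum_half_powers {R : realType} (A B : R) (n : nat) : A != 1 ->
  \sum_(0 <= k < n) A ^+ k./2 * B ^+ odd k
  = (1 + B) * (1 - A ^+ n./2) / (1 - A) + (odd n)%:R * A ^+ n./2.
Proof.
move=> A1; have nz : 1 - A != 0 by rewrite subr_eq0 eq_sym.
elim: n => [|n IH]; first by rewrite big_geq //= mul0r expr0 subrr mulr0 mul0r addr0.
rewrite big_nat_recr //= IH uphalf_half; case: (odd n) => /=.
  by rewrite add1n expr1 [in RHS]exprS; field.
by rewrite add0n expr0; field.
Qed.

Lemma cvg_half : half @ \oo --> \oo.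
Proof. by apply/cvgnyPge => M; exists M.*2 => // n /=; lia. Qed.

Lemma cvg_half_powers {R : realType} (A B : R) : 0 <= A < 1 ->
  (fun n => \sum_(0 <= k < n) A ^+ k./2 * B ^+ odd k) @ \oo --> (1 + B) / (1 - A).
Proof.
move=> /andP[A0 A1].
have Ahalf : (fun n => A ^+ n./2) @ \oo --> (0 : R).
  apply: (cvg_comp half (fun n => A ^+ n) cvg_half); apply: cvg_expr.
  by rewrite ger0_norm.
under eq_fun do rewrite sum_half_powers ?lt_eqF //.
rewrite -[(1 + B) / _]addr0 -{1}[1 + B]mulr1 -{2}[1]subr0; apply: cvgD.
  apply: cvgMl; apply: cvgMr; apply: cvgB => //; exact: cvg_cst.
apply: squeeze_cvgr (cvg_cst 0) Ahalf; apply: nearW => n.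
by case: odd; rewrite ?mul1r ?mul0r ?lexx ?exprn_ge0.
Qed.

Lemma block_factor_ge0 {R : realType} (p : R) s k : 0 <= p <= 1 ->
  0 <= block_factor p s k.
Proof.
move=> p01; have /andP[p0 p1] := p01.
by rewrite mulr_ge0 ?exprn_ge0 ?mulr_ge0 ?a_ge0 ?subr_ge0.
Qed.

Lemma cvg_block_sum {R : realType} (p : R) s : 0 < p < 1 -> (0 < s)%N ->
  (fun n => \sum_(0 <= k < n) block_factor p s k) @ \oo
    --> (1 + (1 - p) * a_ p s.-1) / (1 - a_ p (2 * s)).
Proof.
move=> p01 s0; have /andP[p0 p1] := p01.
by apply: cvg_half_powers; rewrite a_ge0 ?a_lt1 // !ltW.
Qed.

Lemma cvg_block_sumS {R : realType} (p : R) s : 0 < p < 1 -> (0 < s)%N ->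
  (fun n => \sum_(0 <= k < n) block_factor p s k.+1) @ \oo
    --> (a_ p (2 * s) + (1 - p) * a_ p s.-1) / (1 - a_ p (2 * s)).
Proof.
move=> p01 s0; have nz : 1 - a_ p (2 * s) != 0 by rewrite subr_eq0 gt_eqF ?a_lt1.
have -> : (a_ p (2 * s) + (1 - p) * a_ p s.-1) / (1 - a_ p (2 * s)) =
   (1 + (1 - p) * a_ p s.-1) / (1 - a_ p (2 * s)) - 1 by field.
have -> : (fun n => \sum_(0 <= k < n) block_factor p s k.+1) =
   (fun n => \sum_(0 <= k < n.+1) block_factor p s k - 1).
  apply/funext => n; rewrite [in RHS]big_nat_recl //=.
  by rewrite {2}/block_factor /= mulr1 addrAC subrr add0r.
apply: cvgB; last exact: cvg_cst.
by have := cvg_block_sum p s p01 s0; rewrite -cvg_shiftS.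
Qed.

(** The summand of index [l] is the product of the limits in [cvg_block_sum], taken at
    l + 1, and [cvg_block_sumS], taken at l. *)
Lemma summandE {R : realType} (p : R) l : 0 < p < 1 -> (0 < l)%N ->
  summand p l = (1 + (1 - p) * a_ p l) / (1 - a_ p (2 * l.+1))
                * ((a_ p (2 * l) + (1 - p) * a_ p l.-1) / (1 - a_ p (2 * l))).
Proof.
move=> p01 l0; rewrite /summand mulnS addnC.
have nz : 1 - a_ p (2 * l) != 0 by rewrite subr_eq0 gt_eqF ?a_lt1.
have nz' : 1 - a_ p (2 + 2 * l) != 0 by rewrite -mulnS subr_eq0 gt_eqF ?a_lt1.
by field; rewrite nz nz'.
Qed.

Lemma summand_ge0 {R : realType} (p : R) l : 0 < p < 1 -> (0 < l)%N -> 0 <= summand p l.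
Proof.
move=> p01 l0; have /andP[p0 p1] := p01.
have p01' : 0 <= p <= 1 by rewrite !ltW.
rewrite summandE //; apply: mulr_ge0; apply: divr_ge0;
  by rewrite ?subr_ge0 ?a_le1 // addr_ge0 ?mulr_ge0 ?a_ge0 ?subr_ge0 // ltW.
Qed.

(** Both denominators are at least 1 - a_2 = p^2, and in the numerators
    a_(2l) <= a_(l-1) <= 1. *)
Lemma summand_le {R : realType} (p : R) l : 0 < p < 1 -> (0 < l)%N ->
  summand p l <= 4 / p ^+ 4 * a_ p 2 ^+ l.-1./2.
Proof.
move=> p01 l0; have /andP[p0 p1] := p01.
have p01' : 0 <= p <= 1 by rewrite !ltW.
have p20 : 0 < p ^+ 2 by rewrite exprn_gt0.
have denom k : (0 < k)%N -> (1 - a_ p (2 * k))^-1 <= (p ^+ 2)^-1.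
  move=> k0; rewrite lef_pV2 ?posrE ?subr_gt0 ?a_lt1 // lerBrDr -lerBrDl -a_2.
  by apply: a_antitone => //; lia.
have num k : 0 <= a_ p k <= 1 by rewrite a_ge0 ?a_le1.
have /andP[a0 a1] := num l; have /andP[b0 b1] := num l.-1.
have le : a_ p (2 * l) <= a_ p l.-1 by apply: a_antitone => //; lia.
have /andP[c0 c1] := num (2 * l)%N.
rewrite summandE //; apply: (@le_trans _ _ (2 / p ^+ 2 * ((2 * a_ p l.-1) / p ^+ 2))).
  apply: ler_pM; last 2 first.
  - by apply: ler_pM; rewrite ?denom ?invr_ge0 ?subr_ge0 ?a_le1 //; nra.
  - by apply: ler_pM; rewrite ?denom ?invr_ge0 ?subr_ge0 ?a_le1 //; nra.
  - by apply: divr_ge0; rewrite ?subr_ge0 ?a_le1 //; nra.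
  - by apply: divr_ge0; rewrite ?subr_ge0 ?a_le1 //; nra.
have -> : 2 / p ^+ 2 * (2 * a_ p l.-1 / p ^+ 2) = 4 / p ^+ 4 * a_ p l.-1.
  by field; rewrite gt_eqF.
by rewrite ler_pM2l ?a_le_expr // divr_gt0 ?exprn_gt0.
Qed.

Lemma nondecreasing_sum {R : realType} (f : nat -> R) :
  (forall k, 0 <= f k) -> nondecreasing_seq (fun n => \sum_(0 <= k < n) f k).
Proof.
by move=> f0; apply/nondecreasing_seqP => n; rewrite big_nat_recr //= lerDl.
Qed.

Lemma sum_le_lim {R : realType} (f : nat -> R) (l : R) (n : nat) :
  (forall k, 0 <= f k) -> (fun n => \sum_(0 <= k < n) f k) @ \oo --> l ->
  \sum_(0 <= k < n) f k <= l.
Proof.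
move=> f0 fl; rewrite -(cvg_lim (@Rhausdorff R) fl).
by apply: nondecreasing_cvgn_le; [exact: nondecreasing_sum | exact: cvgP fl].
Qed.

Lemma cvg_summand {R : realType} (p : R) : 0 < p < 1 ->
  cvgn (fun n => \sum_(0 <= l < n) summand p l.+1).
Proof.
move=> p01; have /andP[p0 p1] := p01.
have a2 : 0 <= a_ p 2 < 1 by rewrite (a_lt1 p 1) // a_ge0 // !ltW.
apply: nondecreasing_is_cvgn.
  by apply: nondecreasing_sum => k; apply: summand_ge0.
have C0 : 0 <= 4 / p ^+ 4 by rewrite divr_ge0 ?exprn_ge0 // ltW.
exists (4 / p ^+ 4 * ((1 + 1) / (1 - a_ p 2))) => _ [n _ <-].
apply: (@le_trans _ _ (4 / p ^+ 4 * \sum_(0 <= k < n) (a_ p 2 ^+ k./2 * 1 ^+ odd k))).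
  rewrite big_distrr /=; apply: ler_sum => k _.
  by rewrite expr1n mulr1; apply: summand_le.
apply: ler_wpM2l => //; apply: sum_le_lim; last exact: cvg_half_powers.
by move=> k; rewrite expr1n mulr1 exprn_ge0 //; case/andP: a2.
Qed.

(** * Exchange of summations and passage to the limit *)

Definition pair_sum {R : realType} (p : R) (N : nat) : R :=
  \sum_(1 <= k < N.+2) \sum_(1 <= d < k.+1) pair_term p k d.

Definition box_sum {R : realType} (p : R) (L K : nat) : R :=
  \sum_(0 <= l < L) (\sum_(0 <= u < K) block_factor p l.+2 u)
                  * (\sum_(0 <= v < K) block_factor p l.+1 v.+1).

Definition pairs (N : nat) : seq (nat * nat) :=
  [seq (k, d) | k <- index_iota 1 N.+2, d <- index_iota 1 k.+1].

(** An entry (l, (u, v)) stands for the triple (l + 1, u, v + 1) of quotient, remainder, and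
    divisor minus remainder. *)
Definition box (L K : nat) : seq (nat * (nat * nat)) :=
  [seq (l, uv) | l <- iota 0 L, uv <- [seq (u, v) | u <- iota 0 K, v <- iota 0 K]].

Definition box_term {R : realType} (p : R) (x : nat * (nat * nat)) : R :=
  block_factor p x.1.+2 x.2.1 * block_factor p x.1.+1 x.2.2.+1.

Lemma mem_pairs N k d : ((k, d) \in pairs N) = (0 < d <= k)%N && (k <= N.+1)%N.
Proof.
apply/allpairsPdep/idP => [[k' [d' []]]|kd].
  by rewrite !mem_index_iota => + + [-> ->]; lia.
by exists k, d; rewrite !mem_index_iota; split=> //; lia.
Qed.

Lemma mem_box L K l u v : ((l, (u, v)) \in box L K) = [&& l < L, u < K & v < K]%N.
Proof.
apply/allpairsP/and3P => [[[l' uv] [/= + /allpairsP[[u' v'] /= []]]]|[lL uK vK]].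
  by rewrite !mem_iota /= !add0n => lL uK vK -> [-> -> ->].
by exists (l, (u, v)); split; rewrite ?mem_iota //=; apply/allpairsP; exists (u, v);
  rewrite !mem_iota.
Qed.

Lemma pairs_uniq N : uniq (pairs N).
Proof.
by apply: allpairs_uniq_dep => [|k _|[k d] [k' d'] _ _ /= [-> ->]];
  rewrite ?iota_uniq.
Qed.

Lemma box_uniq L K : uniq (box L K).
Proof.
apply: allpairs_uniq; rewrite ?iota_uniq //; last by move=> [? ?] [? ?].
by apply: allpairs_uniq; rewrite ?iota_uniq //; move=> [? ?] [? ?].
Qed.

Lemma pair_sumE {R : realType} (p : R) N :
  pair_sum p N = \sum_(kd <- pairs N) pair_term p kd.1 kd.2.
Proof. by rewrite big_allpairs_dep. Qed.

Lemma box_sumE {R : realType} (p : R) L K :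
  box_sum p L K = \sum_(x <- box L K) box_term p x.
Proof.
rewrite big_allpairs_dep /box_sum /index_iota subn0; apply: eq_bigr => l _.
rewrite big_allpairs_dep big_distrl /= subn0; apply: eq_bigr => u _.
by rewrite big_distrr.
Qed.

(** This is Euclidean division of k = n + 1 by d, so [of_box] is its inverse. *)
Definition to_box (kd : nat * nat) : nat * (nat * nat) :=
  ((kd.1 %/ kd.2).-1, (kd.1 %% kd.2, (kd.2 - kd.1 %% kd.2).-1))%N.

Definition of_box (x : nat * (nat * nat)) : nat * nat :=
  (x.1.+1 * (x.2.1 + x.2.2.+1) + x.2.1, x.2.1 + x.2.2.+1)%N.

Lemma of_boxK : cancel of_box to_box.
Proof.
move=> [l [u v]]; rewrite /of_box /to_box /=.
have uv : (u < u + v.+1)%N by lia.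
rewrite divnMDl ?modnMDl; last by lia.
by rewrite divn_small // modn_small //; do ?congr (_, _); lia.
Qed.

Lemma to_boxK k d : (0 < d <= k)%N -> of_box (to_box (k, d)) = (k, d).
Proof.
move=> /andP[d0 dk]; rewrite /of_box /to_box /=.
have q0 : (0 < k %/ d)%N by rewrite divn_gt0.
have r := ltn_pmod k d0.
have -> : (k %% d + (d - k %% d).-1.+1 = d)%N by lia.
by rewrite prednK // -divn_eq.
Qed.

Lemma pair_term_to_box {R : realType} (p : R) k d : (0 < d <= k)%N ->
  box_term p (to_box (k, d)) = pair_term p k d.
Proof.
move=> /andP[d0 dk]; rewrite /box_term /pair_term /to_box /=.
have q0 : (0 < k %/ d)%N by rewrite divn_gt0.
have r := ltn_pmod k d0.
by rewrite !prednK // subn_gt0.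
Qed.

Lemma pair_sum_le_box {R : realType} (p : R) N : 0 <= p <= 1 ->
  pair_sum p N <= box_sum p N.+2 N.+2.
Proof.
move=> p01; rewrite pair_sumE box_sumE.
rewrite (eq_big_seq (fun kd => box_term p (to_box kd))); last first.
  by move=> [k d]; rewrite mem_pairs => /andP[dk _]; rewrite pair_term_to_box.
apply: ler_sum_inj; rewrite ?pairs_uniq ?box_uniq //.
- move=> [k d] [k' d']; rewrite !mem_pairs => /andP[dk _] /andP[dk' _] e.
  by rewrite -(to_boxK k d) // -(to_boxK k' d') // e.
- move=> [k d]; rewrite mem_pairs => /andP[/andP[d0 dk] kN]; rewrite /to_box mem_box /=.
  have := leq_div k d; have := ltn_pmod k d0; lia.
- by move=> x; rewrite mulr_ge0 ?block_factor_ge0.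
Qed.

(** A triple of the box comes from k <= L (K + K) + K and d <= k. *)
Lemma box_sum_le_pair {R : realType} (p : R) L K N : 0 <= p <= 1 ->
  (2 * (L * K) + K <= N)%N -> box_sum p L K <= pair_sum p N.
Proof.
move=> p01 LKN; rewrite pair_sumE box_sumE.
have term x : box_term p x = pair_term p (of_box x).1 (of_box x).2.
  case: x => l [u v]; rewrite -pair_term_to_box -?surjective_pairing ?of_boxK //=.
  rewrite /= addnS ltn0Sn /= mulSn; lia.
under eq_bigr do rewrite term.
apply: (@ler_sum_inj _ _ _ (box L K) (pairs N) of_box
  (fun kd => pair_term p kd.1 kd.2)); rewrite ?pairs_uniq ?box_uniq //.
- exact: in2W (can_inj of_boxK).
- move=> [l [u v]]; rewrite mem_box => /and3P[lL uK vK]; rewrite mem_pairs /=.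
  have : (l.+1 * (u + v.+1) <= L * (K + K))%N by apply: leq_mul; lia.
  by rewrite mulnDr mulSn; lia.
- by move=> kd; rewrite mulr_ge0 ?block_factor_ge0.
Qed.

Lemma box_sum_le_summand {R : realType} (p : R) L K : 0 < p < 1 ->
  box_sum p L K <= \sum_(0 <= l < L) summand p l.+1.
Proof.
move=> p01; have /andP[p0 p1] := p01; have p01' : 0 <= p <= 1 by rewrite !ltW.
apply: ler_sum => l _; rewrite summandE //.
apply: ler_pM; try by apply: sumr_ge0 => *; apply: block_factor_ge0.
  by apply: sum_le_lim; [move=> k; exact: block_factor_ge0 | exact: (cvg_block_sum p l.+2)].
by apply: sum_le_lim; [move=> k; exact: block_factor_ge0 | exact: (cvg_block_sumS p l.+1)].
Qed.

Lemma cvg_box_sum {R : realType} (p : R) L : 0 < p < 1 ->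
  (fun K => box_sum p L K) @ \oo --> \sum_(0 <= l < L) summand p l.+1.
Proof.
move=> p01; apply: cvg_big => [|l _]; first exact: add_continuous.
rewrite summandE //; apply: cvgM; first exact: (cvg_block_sum p l.+2).
exact: (cvg_block_sumS p l.+1).
Qed.

(** [pair_sum] is nondecreasing and stays below the series, because each truncation
    lies in a box.  Conversely every box is eventually covered, so the limit of [pair_sum]
    is at least that of each box; the sides of the box in u and v tend to
    infinity first, then its side in l. *)
Lemma cvg_pair_sum {R : realType} (p : R) : 0 < p < 1 ->
  (fun N => pair_sum p N) @ \oo -->
    limn (fun n => \sum_(0 <= l < n) summand p l.+1).
Proof.
move=> p01; have /andP[p0 p1] := p01; have p01' : 0 <= p <= 1 by rewrite !ltW.
set S := limn _; have cS := cvg_summand p p01.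
have le_S N : pair_sum p N <= S.
  apply: le_trans (pair_sum_le_box p N p01') _.
  apply: le_trans (box_sum_le_summand p _ _ p01) _.
  by apply: sum_le_lim; [move=> k; apply: summand_ge0 | exact: cS].
have T_nd : nondecreasing_seq (pair_sum p).
  apply/nondecreasing_seqP => N; rewrite /pair_sum [leRHS]big_nat_recr //= lerDl.
  by apply: sumr_ge0 => d _; rewrite mulr_ge0 ?block_factor_ge0.
have cT : cvgn (pair_sum p).
  by apply: nondecreasing_is_cvgn => //; exists S => _ [N _ <-].
suff <- : limn (pair_sum p) = S by [].
apply/eqP; rewrite eq_le limr_le //=; last exact: nearW.
apply: limr_le => //; apply: nearW => L.
rewrite -(cvg_lim (@Rhausdorff R) (cvg_box_sum p L p01)).
apply: limr_le; first exact: cvgP (cvg_box_sum p L p01).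
apply: nearW => K; apply: le_trans (box_sum_le_pair p L K _ p01' (leqnn _)) _.
exact: nondecreasing_cvgn_le.
Qed.

Theorem proposition5p1 (R : realType) (p : R) (hp0 : 0 < p) (hp1 : p < 1) :
  cvgn (fun n : nat => \sum_(1 <= l < n) summand p l) /\
  (fun N : nat => EY2 p N) @ \oo -->
    - (2 / p ^+ 2 - 1 / p - 1) + 2 * limn (fun n : nat => \sum_(1 <= l < n) summand p l).
Proof.
have p01 : 0 < p < 1 by rewrite hp0.
have shift : (fun n => \sum_(0 <= l < n) summand p l.+1)
           = (fun n => \sum_(1 <= l < n.+1) summand p l).
  by apply/funext => n; rewrite big_add1.
have cS := cvg_summand p p01.
have S_cvg : (fun n => \sum_(1 <= l < n) summand p l) @ \oo -->
    limn (fun n => \sum_(0 <= l < n) summand p l.+1).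
  by rewrite -cvg_shiftS; move: cS; rewrite shift; exact.
rewrite (cvg_lim (@Rhausdorff R) S_cvg); split; first exact: S_cvg.
under eq_fun do rewrite EY2E.
rewrite addrC; apply: cvgB; first by apply: cvgMr; exact: cvg_pair_sum.
have -> : 2 / p ^+ 2 - 1 / p - 1 = (1 - p ^+ 2 + (1 - p)) / (1 - (1 - p ^+ 2)).
  by rewrite subKr; field; rewrite gt_eqF.
have -> : (fun N => \sum_(1 <= k < N.+2) block_factor p 1 k)
        = (fun N => \sum_(0 <= k < N.+1) block_factor p 1 k.+1).
  by apply/funext => N; rewrite big_add1.
by have := cvg_block_sumS p 1 p01 isT; rewrite a_0 a_2 mulr1 -cvg_shiftS.
Qed.
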